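(* Let $(A,\mu,\alpha)$ be a Hom-associative algebra. Then $$A_T=(A,\ (,,)=\mu\circ(\mu\otimes\alpha),\ \alpha^2)$$ (with both twisting maps equal to $\alpha^2=\alpha\circ\alpha$) is a ternary totally Hom-associative algebra. Moreover, if $A$ is multiplicative, then so is $A_T$.
   Context: We work over a fixed field $\mathbf{k}$ of characteristic $0$. A Hom-associative algebra $(A,\mu,\alpha)$ is a $\mathbf{k}$-module $A$ with a bilinear map $\mu\colon A^{\otimes 2}\to A$ and a linear map $\alpha\colon A\to A$ such that $\mu\circ(\mu\otimes\alpha)=\mu\circ(\alpha\otimes\mu)$, i.e. $(xy)\alpha(z)=\alpha(x)(yz)$ for all $x,y,z$, writing $\mu(x,y)=xy$. It is multiplicative if $\alpha\circ\mu=\mu\circ\alpha^{\otimes 2}$. A ternary totally Hom-associative algebra $(V,(,,),(\alpha_1,\alpha_2))$ is a $\mathbf{k}$-module $V$ with a trilinear map $(,,)\colon V^{\otimes 3}\to V$, written $(xyz)$, and linear maps $\alpha_1,\alpha_2\colon V\to V$ (twisting maps) such that $((uvw)\alpha_1(x)\alpha_2(y))=(\alpha_1(u)(vwx)\alpha_2(y))=(\alpha_1(u)\alpha_2(v)(wxy))$ for all $u,v,w,x,y\in V$. It is multiplicative if $\alpha_1=\alpha_2$ and this common map $\gamma$ satisfies $\gamma\circ(,,)=(,,)\circ\gamma^{\otimes 3}$. When the twisting maps are equal only the common value is written. *)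

(* Defs.v *)
From HB Require Import structures.
From mathcomp Require Import all_boot all_algebra.

Set Implicit Arguments.
Unset Strict Implicit.
Unset Printing Implicit Defensive.

Import GRing.Theory.
Local Open Scope ring_scope.

(* Linear maps out of tensor powers A^{⊗2}, V^{⊗3} are represented by the
   corresponding curried multilinear functions. *)

Definition trilinear (k : fieldType) (V : lmodType k) (t : V -> V -> V -> V)
  : Prop :=
  [/\ forall y z, linear (fun x => t x y z),
      forall x z, linear (fun y => t x y z)
    & forall x y, linear (fun z => t x y z)].

Record hom_associative_algebra (k : fieldType) (A : lmodType k)
    (mu : A -> A -> A) (alpha : A -> A) : Prop := HomAssociativeAlgebra {
  hom_mul_bilinear : bilinear_for *:%R *:%R mu;
  hom_twist_linear : linear alpha;
  hom_associativity : forall x y z,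
    mu (mu x y) (alpha z) = mu (alpha x) (mu y z)
}.

Definition hom_multiplicative (k : fieldType) (A : lmodType k)
    (mu : A -> A -> A) (alpha : A -> A) : Prop :=
  forall x y, alpha (mu x y) = mu (alpha x) (alpha y).

Record ternary_totally_hom_associative_algebra (k : fieldType)
    (V : lmodType k) (t : V -> V -> V -> V) (alpha1 alpha2 : V -> V) : Prop :=
  TernaryTotallyHomAssociativeAlgebra {
  ternary_mul_trilinear : trilinear t;
  ternary_twist1_linear : linear alpha1;
  ternary_twist2_linear : linear alpha2;
  ternary_hom_associativity : forall u v w x y,
    t (t u v w) (alpha1 x) (alpha2 y) = t (alpha1 u) (t v w x) (alpha2 y) /\
    t (alpha1 u) (t v w x) (alpha2 y) = t (alpha1 u) (alpha2 v) (t w x y)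
}.

Definition ternary_multiplicative (k : fieldType) (V : lmodType k)
    (t : V -> V -> V -> V) (alpha1 alpha2 : V -> V) : Prop :=
  alpha1 =1 alpha2 /\
  forall x y z, alpha1 (t x y z) = t (alpha1 x) (alpha1 y) (alpha1 z).

(* mu ∘ (mu ⊗ alpha) *)
Definition ternary_product (k : fieldType) (A : lmodType k)
    (mu : A -> A -> A) (alpha : A -> A) : A -> A -> A -> A :=
  fun x y z => mu (mu x y) (alpha z).

(* Main.v *)
Require Import Defs.
From HB Require Import structures.
From mathcomp Require Import all_boot all_algebra.

Set Implicit Arguments.
Unset Strict Implicit.
Unset Printing Implicit Defensive.

Import GRing.Theory.
Local Open Scope ring_scope.

(** Expanded, the three ternary bracketings are (((uv)αw)α²x)α³y, (α²u((vw)αx))α³y and (α²u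
    α²v)α((wx)αy). The powers of α are exactly those that let Hom-associativity shift brackets, so
    [assoc] alone links all three, without multiplicativity. *)

Theorem theorem4p6 (k : fieldType) (char0 : [pchar k] =i pred0)
    (A : lmodType k) (mu : A -> A -> A) (alpha : A -> A)
    (hA : hom_associative_algebra mu alpha) :
  ternary_totally_hom_associative_algebra
    (ternary_product mu alpha) (alpha \o alpha) (alpha \o alpha) /\
  (hom_multiplicative mu alpha ->
   ternary_multiplicative
     (ternary_product mu alpha) (alpha \o alpha) (alpha \o alpha)).
Proof.
case: hA => -[mul_linl mul_linr] alpha_lin assoc.
have muDl a x y z : mu (a *: x + y) z = a *: mu x z + mu y z.
  exact: mul_linl z a x y.
have muDr a x y z : mu x (a *: y + z) = a *: mu x y + mu x z.
  exact: mul_linr x a y z.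
have twist2_lin : linear (alpha \o alpha).
  by move=> a x y /=; rewrite !alpha_lin.
split; last first.
  by move=> mult; split=> // x y z; rewrite /ternary_product /= !mult.
split=> //.
  split=> [y z|x z|x y] a u v; rewrite /ternary_product.
  - by rewrite !muDl.
  - by rewrite muDr muDl.
  - by rewrite alpha_lin muDr.
move=> u v w x y; rewrite /ternary_product /=; split.
  (* Inside the outer factor α³y, α²u((vw)αx) = (αu(vw))α²x = ((uv)αw)α²x. *)
  by rewrite -(assoc (alpha u)) -(assoc u) assoc.
(* Once (vw)αx is turned into αv(wx), both sides normalize to the right-nested α³u(α²v(αw(xy))). *)
by rewrite (assoc v w x) !assoc.
Qed.
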